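(* Let $n,m\in\mathbb{N}$, let $R$ be a set of jump sizes containing some $r$ with $m>1$, $m\mid\gcd(n,r)$ and $m^3\mid n$. Let $V_{n,m}(C_n(R))=\{\theta_{n,m,t}(C_n(R)): t=0,1,\dots,\tfrac{n}{m}-1\}$, with the operation $\circ$ defined by $\theta_{n,m,t}(C_n(R))\circ\theta_{n,m,t'}(C_n(R))=\theta_{n,m,t+t'}(C_n(R))$, where $t+t'$ is computed modulo $\tfrac{n}{m}$. Then $(V_{n,m}(C_n(R)),\circ)$ is an Abelian group.
   Context: Circulant graph $C_n(R)$: vertex set $\{v_0,\dots,v_{n-1}\}$ (indices in $\mathbb{Z}_n$), with $v_x$ adjacent to $v_{x\pm s}$ for $s\in R$; jump sets are written in $[1,n/2]$ after reflexive reduction (reduce modulo $n$, replace values $>n/2$ by $n$ minus the value). For $m\mid n$ and $0\le t\le \tfrac nm-1$, the map $\theta_{n,m,t}$ sends vertex $v_x$, where $x=qm+j$ with $0\le j\le m-1$, to $u_{x+jmt}$ (subscripts modulo $n$), with $V(K_n)=\{u_0,\dots,u_{n-1}\}$, and sends each edge $(v_x,v_{x+s})$, $s\in R$, to $(\theta_{n,m,t}(v_x),\theta_{n,m,t}(v_{x+s}))$; $\theta_{n,m,t}(C_n(R))$ denotes the resulting image graph, written $C_n(\theta_{n,m,t}(R))$ with $\theta_{n,m,t}(R)$ computed under reflexive modulo $n$. *)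

(* Defs.v *)
From HB Require Import structures.
From mathcomp Require Import all_boot all_algebra.

Set Implicit Arguments.
Unset Strict Implicit.
Unset Printing Implicit Defensive.

Import GRing.Theory.
Local Open Scope ring_scope.

(* A labelled graph, as the pair of its vertex set and its edge set; graphs
   are compared by Leibniz equality, i.e. as labelled graphs, not up to
   isomorphism. *)
Definition graph (T : finType) : Type := ({set T} * {set {set T}})%type.
HB.instance Definition _ (T : finType) := Finite.on (graph T).

Definition graph_image (T U : finType) (f : T -> U) (G : graph T) : graph U :=
  (f @: G.1, [set f @: (e : {set T}) | e in G.2]).

(* As x ranges over all of 'Z_n, the edges {x, x + s} account for both of the
   neighbours x + s and x - s of x. 'Z_n is the integers modulo n only when
   1 < n. *)
Definition circulant (n : nat) (R : {set 'Z_n}) : graph 'Z_n :=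
  ([set: 'Z_n], [set [set x; x + s] | x in [set: 'Z_n], s in R]).

(* If x = q m + j with 0 <= j < m then x is sent to x + j m t modulo n; here
   x is identified with its representative in {0, ..., n - 1}. *)
Definition theta (n m t : nat) (x : 'Z_n) : 'Z_n :=
  x + ((x %% m) * m * t)%N%:R.

Definition theta_circulant (n m : nat) (R : {set 'Z_n}) (t : nat) : graph 'Z_n :=
  graph_image (theta m t) (circulant R).

Definition Vset (n m : nat) (R : {set 'Z_n}) : {set graph 'Z_n} :=
  [set theta_circulant m R t | t : 'I_(n %/ m)].

(* The values of op outside A are irrelevant. *)
Definition abelian_group_on (T : finType) (A : {set T}) (op : T -> T -> T) : Prop :=
  [/\ {in A &, forall x y, op x y \in A},
      {in A & &, associative op},
      {in A &, commutative op} &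
      exists e : T, [/\ e \in A,
        {in A, left_id e op} &
        {in A, forall x, exists2 y, y \in A & op y x = e}]].

(* Main.v *)
Require Import Defs.
From mathcomp Require Import all_boot all_algebra.

(** The map theta_t preserves residues modulo m because m divides n, so
    theta_s o theta_t = theta_(s + t). Hence the image graphs form an orbit of
    the cyclic group Z/(n/m), and equal images stay equal after a further
    theta_u: the rule for the operation does not depend on representatives. *)

Import GRing.Theory.

Section CyclicIndexing.

Context {T : finType} {f : nat -> T} {N : nat}.
Hypothesis N_gt0 : (0 < N)%N.
Hypothesis f_mod : forall t, f (t %% N)%N = f t.
Hypothesis f_add : forall s t u, f s = f t -> f (s + u)%N = f (t + u)%N.

Lemma cyclic_indexing_op : exists op : T -> T -> T,
  forall s t, op (f s) (f t) = f (s + t)%N.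
Proof.
(* [idx] chooses some index of [x]; the default [0] occurs only outside the image of [f]. *)
pose idx x := if [pick t : 'I_N | f t == x] is Some t then val t else 0%N.
have idxK t : f (idx (f t)) = f t.
  rewrite /idx; case: pickP => [i /eqP //|/(_ (Ordinal (ltn_pmod t N_gt0)))].
  by rewrite /= f_mod eqxx.
exists (fun x y => f (idx x + idx y)%N) => s t.
(* [f_add] replaces only the left summand, so commuting the sum gives access to the other index. *)
rewrite (f_add _ _ _ (idxK s)) addnC (f_add _ _ _ (idxK t)).
by rewrite addnC.
Qed.

Lemma cyclic_indexing_abelian_group (op : T -> T -> T) :
  (forall s t, op (f s) (f t) = f (s + t)%N) ->
  abelian_group_on [set f t | t : 'I_N] op.
Proof.
move=> opE.
have f_in t : f t \in [set f t | t : 'I_N].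
  by apply/imsetP; exists (Ordinal (ltn_pmod t N_gt0)); rewrite //= f_mod.
split.
- by move=> _ _ /imsetP[s _ ->] /imsetP[t _ ->]; rewrite opE.
- move=> _ _ _ /imsetP[s _ ->] /imsetP[t _ ->] /imsetP[u _ ->].
  by rewrite !opE addnA.
- by move=> _ _ /imsetP[s _ ->] /imsetP[t _ ->]; rewrite !opE addnC.
- exists (f 0%N); split=> [//|_ /imsetP[t _ ->]|_ /imsetP[t _ ->]].
    by rewrite opE.
  (* For [t = 0] the index [N - t] is [N], outside ['I_N]; [f_in] covers it by reduction modulo
     [N]. *)
  exists (f (N - t)%N) => //.
  by rewrite opE subnK 1?ltnW // -f_mod modnn.
Qed.

End CyclicIndexing.

Section Theta.

Context {n m : nat}.
Hypothesis n_gt1 : (1 < n)%N.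
Hypothesis m_dvd_n : (m %| n)%N.

Lemma theta_modn t (x : 'Z_n) : theta m t x = x %[mod m].
Proof.
have m_dvd : m %| (Zp_trunc n).+2 by rewrite Zp_cast.
rewrite /theta /= modn_dvdm // val_Zp_nat // -modnDmr modn_dvdm //.
by rewrite mulnAC modnMl addn0.
Qed.

Lemma theta_comp s t (x : 'Z_n) : theta m s (theta m t x) = theta m (t + s) x.
Proof. by rewrite {1}/theta theta_modn /theta -addrA -natrD -mulnDr. Qed.

(** Since [m * (n %/ m) = n], the shift [k * m * t] modulo [n] depends only on [t] modulo
    [n %/ m]. *)
Lemma theta_mod t (x : 'Z_n) : theta m (t %% (n %/ m)) x = theta m t x.
Proof.
have eq_mod k : k * m * (t %% (n %/ m)) = k * m * t %[mod n].
  by rewrite -!mulnA muln_modr (mulnC m (n %/ m)) divnK // modnMmr.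
by rewrite /theta -[in LHS]Zp_nat_mod // eq_mod Zp_nat_mod.
Qed.

Lemma theta_circulant_mod (R : {set 'Z_n}) t :
  theta_circulant m R (t %% (n %/ m)) = theta_circulant m R t.
Proof.
rewrite /theta_circulant /graph_image; congr pair.
  exact/eq_imset/theta_mod.
by apply: eq_imset => e; apply/eq_imset/theta_mod.
Qed.

(** Adding [u] to the index amounts to applying a map that depends on [u] alone, hence equal graphs
    stay equal. *)
Lemma theta_circulantD (R : {set 'Z_n}) t u :
  theta_circulant m R (t + u) = graph_image (theta m u) (theta_circulant m R t).
Proof.
rewrite /theta_circulant /graph_image /= -!imset_comp; congr pair.
  by apply: eq_imset => x; rewrite /= theta_comp.
apply: eq_imset => e; rewrite /= -imset_comp.
by apply: eq_imset => x; rewrite /= theta_comp.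
Qed.

End Theta.

(* The operation on Vset is determined by the displayed rule; its existence is
   the assertion that the rule does not depend on the choice of t and t'. *)
Theorem theorem5p2 (n m : nat) (R : {set 'Z_n}) (r : 'Z_n)
    (jumps : forall s : 'Z_n, s \in R -> (1 <= s <= n./2)%N)
    (rR : r \in R) (m_gt1 : (1 < m)%N)
    (m_dvd : (m %| gcdn n r)%N) (m3_dvd : (m ^ 3 %| n)%N) :
  exists op : graph 'Z_n -> graph 'Z_n -> graph 'Z_n,
    (forall t t' : 'I_(n %/ m),
       op (theta_circulant m R t) (theta_circulant m R t')
       = theta_circulant m R ((t + t') %% (n %/ m))%N)
    /\ abelian_group_on (Vset m R) op.
Proof.
have n_gt1 : (1 < n)%N.
  (* The bounds [1 <= r <= n./2] rule out [n = 0] and [n = 1]. *)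
  have /andP[r_gt0 r_le] := jumps r rR.
  by case: (n) (leq_trans r_gt0 r_le) => [|[]].
have m_dvd_n : (m %| n)%N := dvdn_trans m_dvd (dvdn_gcdl n r).
have N_gt0 : (0 < n %/ m)%N.
  by rewrite divn_gt0 ?(ltnW m_gt1) // dvdn_leq // (ltnW n_gt1).
have f_mod := theta_circulant_mod n_gt1 m_dvd_n R.
have f_add s t u : theta_circulant m R s = theta_circulant m R t ->
    theta_circulant m R (s + u) = theta_circulant m R (t + u).
  by move=> eq_st; rewrite !theta_circulantD ?eq_st.
have [op opE] := cyclic_indexing_op N_gt0 f_mod f_add.
exists op; split=> [t t'|]; first by rewrite opE f_mod.
exact: cyclic_indexing_abelian_group.
Qed.
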